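(* Let $\rho\in(0,\pi]$ and $h>0$. Let $X_1,X_2,\ldots$ be i.i.d. observations in $\mathbb{R}^d$ drawn from a distribution $P_X$ with support $S$. Assume that $S$ is compact and standard with respect to $P_X$, and denote $\aleph_n=\{X_1,\ldots,X_n\}$. Assume moreover that $$P_X\big(S\setminus (S\ominus tB(0,1))\big)=\mathcal{O}(t)\quad (t\to 0^+).$$ (a) If $S\in\mathcal{C}_{\rho,h}$, then $$d_{P_X}\big(\mathbb{C}_{\rho,h}(\aleph_n),S\big)=\mathcal{O}\Big(\Big(\frac{\log n}{n}\Big)^{1/d}\Big)\quad\text{a.s.}$$ (b) If $S\in\tilde{\mathcal{C}}_{\rho,h}$, then $$d_{P_X}\big(\tilde{\mathbb{C}}_{\rho,h}(\aleph_n),S\big)=\mathcal{O}\Big(\Big(\frac{\log n}{n}\Big)^{1/d}\Big)\quad\text{a.s.}$$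
   Context: $B(x,h)$ denotes the open Euclidean ball in $\mathbb{R}^d$ and $\mu$ the Lebesgue measure on $\mathbb{R}^d$. For $x\in\mathbb{R}^d$, a unit vector $\xi$, $\rho\in(0,\pi]$ and $h>0$, the finite open cone is $$C_{\rho,\xi,h}(x)=B(x,h)\cap\Big\{z\in\mathbb{R}^d,\ z\ne x:\ \Big\langle \xi,\frac{z-x}{\|z-x\|}\Big\rangle>\cos(\rho/2)\Big\}.$$ $\mathcal{C}_{\rho,h}$ is the class of nonempty compact sets $S\subset\mathbb{R}^d$ such that for every $x\in\partial S$ there is a unit vector $\xi$ with $C_{\rho,\xi,h}(x)\subset S^c$. $\tilde{\mathcal{C}}_{\rho,h}$ is the class of nonempty compact sets $S\subset\mathbb{R}^d$ such that $S$ equals the intersection of the complements of all cones $C_{\rho,\xi,h}(y)$ ($y\in\mathbb{R}^d$, $\|\xi\|=1$) disjoint from $S$. For a bounded set $A\subset\mathbb{R}^d$, $\mathbb{C}_{\rho,h}(A)$ is the intersection of all sets $B\in\mathcal{C}_{\rho,h}$ with $A\subset B$; $\tilde{\mathbb{C}}_{\rho,h}(A)$ is the intersection of the complements of all cones $C_{\rho,\xi,h}(y)$ disjoint from $A$ (equivalently, the intersection of all $B\in\tilde{\mathcal{C}}_{\rho,h}$ with $A\subset B$). A set $S\subset\mathbb{R}^d$ is standard with respect to a Borel measure $\nu$ if there exist $\lambda>0$, $\delta>0$ such that $\nu(B(x,\varepsilon)\cap S)\ge\delta\,\mu(B(x,\varepsilon))$ for all $x\in S$ and $0<\varepsilon\le\lambda$.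 The $t$-inner parallel set is $S\ominus tB(0,1)=\{x\in S: B(x,t)\subset S\}$. For a Borel measure $\nu$, $d_\nu(A,C)=\nu(A\setminus C)+\nu(C\setminus A)$. ''$Z_n=\mathcal{O}(a_n)$ a.s.'' means that, with probability one, $\limsup_n |Z_n|/a_n<\infty$. *)

(* Defs.v *)
From HB Require Import structures.
From mathcomp Require Import all_boot all_order all_algebra.
From mathcomp Require Import all_classical all_reals all_analysis.
From mathcomp Require Import measurable_realfun.

Set Implicit Arguments.
Unset Strict Implicit.
Unset Printing Implicit Defensive.

Import Order.TTheory GRing.Theory Num.Theory.
Import numFieldNormedType.Exports.

Local Open Scope classical_set_scope.
Local Open Scope ring_scope.

Section Euclidean.
Context {R : realType} {d : nat}.
Implicit Types (x y z xi : 'rV[R]_d) (A S : set 'rV[R]_d).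

(* The norm `|x| of the library on 'rV[R]_d is the sup norm; its topology is
   the Euclidean one, so closure, interior, open and compact are the usual
   ones, but the balls are not. *)
Definition dotp x y : R := \sum_i x ord0 i * y ord0 i.
Definition enorm x : R := Num.sqrt (dotp x x).
Definition eball x (r : R) : set 'rV[R]_d := [set z | enorm (z - x) < r].

Definition boundary S : set 'rV[R]_d := closure S `\` interior S.

Definition cone (rho : R) xi (h : R) x : set 'rV[R]_d :=
  eball x h `&`
  [set z | z != x /\ cos (rho / 2) < dotp xi ((enorm (z - x))^-1 *: (z - x))].

Definition cone_class (rho h : R) : set (set 'rV[R]_d) :=
  [set S | [/\ S !=set0, compact S &
    forall x, boundary S x ->
      exists xi, enorm xi = 1 /\ cone rho xi h x `<=` ~` S]].

Definition cone_hull (rho h : R) A : set 'rV[R]_d :=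
  \bigcap_(B in [set B | cone_class rho h B /\ A `<=` B]) B.

(* The global (complement-of-cones) hull and class, written with a tilde in the
   literature; a cone is indexed by its apex p.1 and its axis p.2. *)
Definition ccone_hull (rho h : R) A : set 'rV[R]_d :=
  \bigcap_(p in [set p : 'rV[R]_d * 'rV[R]_d |
                 enorm p.2 = 1 /\ cone rho p.2 h p.1 `&` A = set0])
    ~` cone rho p.2 h p.1.

Definition ccone_class (rho h : R) : set (set 'rV[R]_d) :=
  [set S | [/\ S !=set0, compact S & S = ccone_hull rho h S]].

Definition inner_parallel S (t : R) : set 'rV[R]_d :=
  [set x | S x /\ eball x t `<=` S].

Definition borel_rV := g_sigma_algebraType (@open 'rV[R]_d).

End Euclidean.

Arguments borel_rV R d : clear implicits.

(* Lebesgue measure on R^d as the d-fold product of the Lebesgue measure on R,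
   with the section formula of product_measure1 as definition; this is the
   value of Lebesgue measure on Borel sets, in particular on balls. *)
Fixpoint lebesgue_rV (R : realType) (d : nat) : set 'rV[R]_d -> \bar R :=
  match d with
  | 0 => fun A => (\1_A 0%R)%:E
  | d'.+1 => fun A => \int[lebesgue_measure]_(t in [set: R])
      lebesgue_rV [set v : 'rV[R]_d' | A (row_mx (t%:M : 'M[R]_1) v)]
  end%E.

Lemma lebesgue_rV0 (R : realType) (d : nat) :
  lebesgue_rV (set0 : set 'rV[R]_d) = 0%E.
Proof.
elim: d => [|d IH] /=; first by rewrite indicE in_set0.
by under eq_integral do rewrite (_ : mkset _ = set0) ?IH //; rewrite integral0.
Qed.

Lemma lebesgue_rV_box (R : realType) (d : nat) (a b : 'rV[R]_d) :
  (forall i, a ord0 i <= b ord0 i) ->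
  lebesgue_rV [set v | forall i, a ord0 i <= v ord0 i <= b ord0 i] =
  (\prod_i (b ord0 i - a ord0 i))%:E.
Proof.
elim: d a b => [|d IH] a b ab /=.
  by rewrite big_ord0 indicE mem_set // => -[].
pose I : set R := [set` `[a ord0 ord0, b ord0 ord0]].
pose c := \prod_i (b ord0 (lift ord0 i) - a ord0 (lift ord0 i)).
have c_ge0 : 0 <= c by apply: prodr_ge0 => i _; rewrite subr_ge0.
have E (t : R) : lebesgue_rV [set v : 'rV[R]_d | forall i,
     a ord0 i <= row_mx (t%:M : 'M[R]_1) v ord0 i <= b ord0 i] =
     (c%:E * (\1_I t)%:E)%E.
  have r0 v : row_mx (t%:M : 'M[R]_1) v ord0 (ord0 : 'I_(1 + d)) = t.
    transitivity (row_mx (t%:M : 'M[R]_1) v ord0 (lshift d ord0)).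
      by congr (row_mx _ _ _ _); exact/val_inj.
    by rewrite row_mxEl mxE eqxx.
  have rS v i : row_mx (t%:M : 'M[R]_1) v ord0 (lift ord0 i : 'I_(1 + d)) =
      v ord0 i.
    transitivity (row_mx (t%:M : 'M[R]_1) v ord0 (rshift 1 i)).
      by congr (row_mx _ _ _ _); exact/val_inj.
    by rewrite row_mxEr.
  have [tI|tI] := boolP (t \in I).
    rewrite indicE tI mule1.
    have := IH (\row_i a ord0 (lift ord0 i)) (\row_i b ord0 (lift ord0 i)).
    under eq_bigr do rewrite !mxE.
    move=> <-; last by move=> i; rewrite !mxE.
    congr lebesgue_rV; apply/seteqP; split=> v /= H i.
      by rewrite !mxE -(rS v i); exact: H.
    have [->|[j ->]] : i = ord0 \/ exists j, i = lift ord0 j.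
    - by case: (unliftP ord0 i) => [j|] ->; [right; exists j | left].
    - by rewrite r0; move: tI; rewrite inE /I /= in_itv.
    - by rewrite rS; have := H j; rewrite !mxE.
  rewrite indicE (negbTE tI) mule0 (_ : mkset _ = set0) ?lebesgue_rV0 //.
  apply/seteqP; split=> v //= /(_ ord0); rewrite r0 => tab.
  by move/negP: tI; apply; rewrite inE /I /= in_itv.
under eq_integral do rewrite E.
rewrite ge0_integralZl //; last first.
  by apply/measurable_EFinP; apply: measurable_indic; exact: measurable_itv.
rewrite integral_indic ?setIT //; last exact: measurable_itv.
rewrite [X in (_ * X)%E](lebesgue_measure_itv `[a ord0 ord0, b ord0 ord0]) /= lte_fin big_ord_recl.
case: (ltP (a ord0 ord0) (b ord0 ord0)) => [_|ba].
  by rewrite -EFinB -EFinM mulrC.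
by rewrite (le_anti (introT andP (conj ba (ab _)))) subrr mul0r mule0.
Qed.

Section BorelMeasures.
Context {R : realType} {d : nat}.
Implicit Types (nu : {measure set (borel_rV R d) -> \bar R})
  (A C S : set 'rV[R]_d).

Definition msupport nu : set 'rV[R]_d :=
  [set x | forall U : set 'rV[R]_d, open U -> U x -> (0 < nu U)%E].

Definition standard nu S :=
  exists lam delta : R, [/\ 0 < lam, 0 < delta &
    forall x (eps : R), S x -> 0 < eps <= lam ->
      (delta%:E * lebesgue_rV (eball x eps) <= nu (eball x eps `&` S))%E].

Definition dmeas nu A C : \bar R := (nu (A `\` C) + nu (C `\` A))%E.

End BorelMeasures.

Section Sampling.
Context {disp disp' : measure_display} {Omega : measurableType disp}
  {T : measurableType disp'} {R : realType}.
Context (P : probability Omega R).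

Definition mutually_independent (X : nat -> Omega -> T) :=
  forall (s : seq nat) (A : nat -> set T), uniq s ->
    (forall i, measurable (A i)) ->
    P (\bigcap_(i in [set` s]) (X i @^-1` A i)) =
    (\prod_(i <- s) P (X i @^-1` A i))%E.

Definition iid_sample (X : nat -> {RV P >-> T}) (Q : probability T R) :=
  mutually_independent X /\
  forall i A, measurable A -> distribution P (X i) A = Q A.

(* Where a n = 0 (for log_rate: n = 0, 1) the quotient is 0; finitely many such
   n do not affect the upper limit. *)
Definition as_bigO (Z : nat -> Omega -> \bar R) (a : nat -> R) :=
  {ae P, forall w,
    (limn_esup (fun n => `|Z n w| * ((a n)^-1)%:E) < +oo)%E}.

End Sampling.

(* Indices start at 0: X 0, ..., X n.-1 are the first n observations. *)
Definition sample_set {Omega T : Type} (X : nat -> Omega -> T) (n : nat)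
  (w : Omega) : set T := [set X i w | i in `I_n].

Definition log_rate {R : realType} (d n : nat) : R :=
  (ln n%:R / n%:R) `^ d%:R^-1.

(* Main.v *)
Require Import Defs.
From HB Require Import structures.
From mathcomp Require Import all_boot all_order all_algebra.
From mathcomp Require Import all_classical all_reals all_analysis.
From mathcomp Require Import ring lra.

(* If every point of S is within e of the sample and 2 * e <= kappa * h, then
   the inner parallel set of S at distance 4 * e / kappa is contained in the
   hull, where kappa = (1 - cos (rho / 2)) / 4. For the global hull, a cone
   containing a point x but no sample point contains, by convexity, a ball of
   radius e close to x; for the local hull, a set B of the class containing the
   sample but not x has a boundary point within e of x, and the corresponding
   outer cone contains a ball of radius e near its apex. In both cases the
   centre of the ball lies in S, so the ball contains a sample point, which is
   absurd. Hence the distance in measure is at most the mass of S outside an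
   inner parallel set, which is O(e) by assumption.
   That e = O((ln n / n)^(1/d)) almost surely follows from standardness: a
   maximal separated subset of S is small, a union bound controls the
   probability that one of its balls is missed, and Borel-Cantelli concludes. *)

Set Implicit Arguments.
Unset Strict Implicit.
Unset Printing Implicit Defensive.

Import Order.TTheory GRing.Theory Num.Theory.
Import numFieldNormedType.Exports.

Local Open Scope classical_set_scope.
Local Open Scope ring_scope.

(** * Euclidean inner product, norm and balls *)

Section EuclideanNorm.
Context {R : realType} {d : nat}.
Implicit Types (x y z xi : 'rV[R]_d) (A S : set 'rV[R]_d) (k r : R).

Lemma dotpC x y : dotp x y = dotp y x.
Proof. by apply: eq_bigr => i _; rewrite mulrC. Qed.

Lemma dotpDr x y z : dotp x (y + z) = dotp x y + dotp x z.
Proof. by rewrite -big_split; apply: eq_bigr => i _; rewrite mxE mulrDr. Qed.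

Lemma dotpZr k x y : dotp x (k *: y) = k * dotp x y.
Proof. by rewrite mulr_sumr; apply: eq_bigr => i _; rewrite mxE mulrCA. Qed.

Lemma dotpDl x y z : dotp (y + z) x = dotp y x + dotp z x.
Proof. by rewrite dotpC dotpDr !(dotpC x). Qed.

Lemma dotpZl k x y : dotp (k *: y) x = k * dotp y x.
Proof. by rewrite dotpC dotpZr dotpC. Qed.

Lemma dotp_ge0 x : 0 <= dotp x x.
Proof. by apply: sumr_ge0 => i _; rewrite -expr2 sqr_ge0. Qed.

Lemma enorm_ge0 x : 0 <= enorm x. Proof. exact: sqrtr_ge0. Qed.

Lemma enorm_sqr x : enorm x ^+ 2 = dotp x x.
Proof. by rewrite sqr_sqrtr ?dotp_ge0. Qed.

Lemma coord_le_enorm x i : `|x ord0 i| <= enorm x.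
Proof.
rewrite -ler_sqr ?nnegrE ?enorm_ge0 // enorm_sqr /dotp (bigD1 i) //=.
rewrite -normrX ger0_norm ?sqr_ge0 // -expr2 lerDl.
by apply: sumr_ge0 => j _; rewrite -expr2 sqr_ge0.
Qed.

Lemma enorm_le_coord x r : (forall i, `|x ord0 i| <= r) -> 0 <= r ->
  enorm x <= d%:R * r.
Proof.
move=> xr r0; rewrite -ler_sqr ?nnegrE ?enorm_ge0 ?mulr_ge0 // enorm_sqr /dotp.
apply: (@le_trans _ _ (\sum_(i < d) r ^+ 2)).
  apply: ler_sum => i _; rewrite -expr2 -(real_normK (num_real _)).
  by rewrite ler_sqr ?nnegrE ?normr_ge0.
rewrite sumr_const card_ord -[leLHS]mulr_natl exprMn ler_wpM2r ?sqr_ge0 //.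
by rewrite -natrX ler_nat; case: (d) => // n; rewrite leq_pmull.
Qed.

Lemma enorm_eq0 x : enorm x = 0 -> x = 0.
Proof.
move=> x0; apply/rowP => i; rewrite mxE; apply/eqP; rewrite -normr_le0 -x0.
exact: coord_le_enorm.
Qed.

Lemma enormZ k x : enorm (k *: x) = `|k| * enorm x.
Proof.
apply/eqP; rewrite -(eqrXn2 (n := 2)) ?mulr_ge0 ?enorm_ge0 //.
by rewrite exprMn !enorm_sqr dotpZl dotpZr real_normK ?num_real// mulrA -expr2.
Qed.

Lemma enorm0 : enorm (0 : 'rV[R]_d) = 0.
Proof. by rewrite -(scale0r 0) enormZ normr0 mul0r. Qed.

Lemma enormN x : enorm (- x) = enorm x.
Proof. by rewrite -scaleN1r enormZ normrN1 mul1r. Qed.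

Lemma enormB x y : enorm (x - y) = enorm (y - x).
Proof. by rewrite -enormN opprB. Qed.

(** Cauchy-Schwarz: for nonzero vectors, the squared norm of [enorm y *: x - enorm x *: y] is
    nonnegative and equals [2 * (a * b) * (a * b - c)] with [a], [b], [c] as set in the proof. *)
Lemma dotp_le_enorm x y : dotp x y <= enorm x * enorm y.
Proof.
have [x0|x0] := eqVneq (enorm x) 0.
  rewrite x0 mul0r (enorm_eq0 x0) /dotp big1 // => i _.
  by rewrite mxE mul0r.
have [y0|y0] := eqVneq (enorm y) 0.
  rewrite y0 mulr0 (enorm_eq0 y0) /dotp big1 // => i _.
  by rewrite mxE mulr0.
have xp : 0 < enorm x by rewrite lt_def x0 enorm_ge0.
have yp : 0 < enorm y by rewrite lt_def y0 enorm_ge0.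
have := dotp_ge0 (enorm y *: x + - enorm x *: y).
rewrite !(dotpDl, dotpDr, dotpZl, dotpZr) -!enorm_sqr (dotpC y x).
set a := enorm x; set b := enorm y; set c := dotp x y.
rewrite (_ : _ + _ = 2 * (a * b) * (a * b - c)); last by ring.
by rewrite pmulr_rge0 ?subr_ge0 // mulr_gt0 // mulr_gt0.
Qed.

Lemma oppr_enorm_le_dotp x y : - (enorm x * enorm y) <= dotp x y.
Proof.
have := dotp_le_enorm x (- y).
by rewrite enormN -scaleN1r dotpZr mulN1r lerNl.
Qed.

Lemma enormD x y : enorm (x + y) <= enorm x + enorm y.
Proof.
rewrite -ler_sqr ?nnegrE ?addr_ge0 ?enorm_ge0 // enorm_sqr sqrrD !enorm_sqr.
by rewrite !(dotpDl, dotpDr) (dotpC y x); have := dotp_le_enorm x y; lra.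
Qed.

Lemma enorm_triangle x y z : enorm (x - z) <= enorm (x - y) + enorm (y - z).
Proof. by rewrite (le_trans _ (enormD _ _)) // addrA subrK. Qed.

Lemma eball_center x r : 0 < r -> eball x r x.
Proof. by move=> r0; rewrite /eball /= subrr enorm0. Qed.

(** Bridge between the ambient topology, generated by sup-norm balls, and Euclidean balls: around
    each point, either kind of ball contains one of the other kind. *)
Lemma open_eballP A :
  open A <-> forall x, A x -> exists2 r, 0 < r & eball x r `<=` A.
Proof.
split=> [oA x Ax|HA].
  have /nbhs_ballP[r /= r0 rA] := open_nbhs_nbhs (conj oA Ax).
  exists r => // z zx; apply: rA; split=> // i j.
  have -> : z = x + (z - x) by rewrite addrC subrK.
  rewrite /ball /= ord1 !mxE opprD addNKr normrN.
  by apply: le_lt_trans zx; have := coord_le_enorm (z - x) j; rewrite !mxE.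
rewrite openE => x /HA[r r0 rA]; apply/nbhs_ballP.
(* Dividing by [d.+1] rather than [d] makes the final inequality strict and also covers [d = 0]. *)
exists (r / d.+1%:R) => /=; first by rewrite divr_gt0.
move=> z xz; apply: rA; rewrite /eball /=.
have xz' i : `|(z - x) ord0 i| <= r / d.+1%:R.
  by have := xz.2 ord0 i; rewrite /ball /= distrC !mxE => /ltW.
apply: (le_lt_trans (enorm_le_coord xz' _)); first by rewrite divr_ge0 // ltW.
by rewrite mulrCA gtr_pMr // ltr_pdivrMr ?mul1r ?ltr_nat.
Qed.

Lemma open_eball x r : open (eball x r).
Proof.
apply/open_eballP => y yx; exists (r - enorm (y - x)); rewrite ?subr_gt0 //.
move=> z; rewrite /eball /= ltrBrDr; apply: le_lt_trans.
exact: enorm_triangle.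
Qed.

End EuclideanNorm.

(** * Cones, and inclusion of inner parallel sets in the two hulls *)

Section Cones.
Context {R : realType} {d : nat}.
Implicit Types (x y z xi : 'rV[R]_d) (A B S : set 'rV[R]_d).
Implicit Types (rho h e s t : R).

(** The division is cleared, and the condition [z != y] is absorbed because the strict inequality
    fails at the apex. *)
Lemma coneP rho xi h y z : cone rho xi h y z <->
  enorm (z - y) < h /\ cos (rho / 2) * enorm (z - y) < dotp xi (z - y).
Proof.
have [->|zy] := eqVneq z y.
  rewrite /cone /eball /= subrr enorm0 mulr0.
  split=> [[_ []]|[_]]; first by rewrite eqxx.
  by rewrite /dotp big1 ?ltxx // => i _; rewrite mxE mulr0.
have zy0 : 0 < enorm (z - y).
  rewrite lt_def enorm_ge0 andbT; apply: contra_neq zy => /enorm_eq0.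
  exact: subr0_eq.
rewrite /cone /eball /= dotpZr [_^-1 * _]mulrC ltr_pdivlMr //.
by split=> [[? []]|[]].
Qed.

Lemma open_cone rho xi h y : open (cone rho xi h y).
Proof.
apply/open_eballP => z /coneP[zh zc].
pose c := cos (rho / 2); pose g := dotp xi (z - y) - c * enorm (z - y).
(* Moving from [z] to [w] lowers the slack [g] by at most [(enorm xi + |c|) * enorm (w - z)]; the
   summand 1 keeps [M] positive. *)
pose M := 1 + enorm xi + `|c|.
have M1 : 1 <= M by rewrite /M -addrA lerDl addr_ge0 ?enorm_ge0.
have M0 : 0 < M by apply: lt_le_trans M1.
exists (Num.min (h - enorm (z - y)) (g / M)).
  by rewrite lt_min subr_gt0 zh divr_gt0 // subr_gt0.
move=> w; rewrite /eball /= lt_min => /andP[wh]; rewrite ltr_pdivlMr // => wg.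
apply/coneP; split.
  by have := enorm_triangle w z y; lra.
have -> : w - y = (w - z) + (z - y) by rewrite addrA subrK.
rewrite dotpDr.
have h1 : - (enorm xi * enorm (w - z)) <= dotp xi (w - z).
  exact: oppr_enorm_le_dotp.
have h2 : `|enorm (w - z + (z - y)) - enorm (z - y)| <= enorm (w - z).
  rewrite ler_norml lerBlDr enormD andbT.
  have := enormD (w - z + (z - y)) (- (w - z)).
  by rewrite addrAC subrr add0r enormN; lra.
have h3 : c * (enorm (w - z + (z - y)) - enorm (z - y)) <=
    `|c| * enorm (w - z).
  by rewrite (le_trans (ler_norm _)) // normrM ler_wpM2l.
by move: wg; rewrite /g /M -/c; have := enorm_ge0 (w - z); lra.
Qed.

Lemma half_angle_cos rho : 0 < rho <= pi -> 0 <= cos (rho / 2) < 1.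
Proof.
move=> /andP[r0 rpi]; have p0 := pi_gt0 R; apply/andP; split.
  by apply: cos_ge0_pihalf; apply/andP; split; lra.
have rin : rho / 2 \in `[0, pi] by rewrite in_itv /=; apply/andP; split; lra.
have in0 : 0 \in `[0, (pi : R)] by rewrite in_itv /= lexx ltW.
by rewrite -[ltRHS]cos0 ltr_cos // divr_gt0.
Qed.

(* The point of the axis at distance [s] from the apex is the centre of an
   inscribed ball of radius [cone_ratio rho * s]. *)
Definition cone_ratio rho : R := (1 - cos (rho / 2)) / 4.

Lemma cone_ratio_bounds rho : 0 < rho <= pi ->
  0 < cone_ratio rho <= 4^-1.
Proof.
by move=> /half_angle_cos/andP[c0 c1]; rewrite /cone_ratio; apply/andP; lra.
Qed.

Lemma axis_eball_sub_cone rho xi h y s : 0 < rho <= pi -> enorm xi = 1 ->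
  0 < s <= h / 2 ->
  eball (y + s *: xi) (cone_ratio rho * s) `<=` cone rho xi h y.
Proof.
move=> hrho xi1 /andP[s0 sh] z; rewrite /eball /= => zs.
have /andP[c0 c1] := half_angle_cos hrho.
have /andP[k0 k1] := cone_ratio_bounds hrho.
set k := cone_ratio rho in zs k0 k1; set c := cos (rho / 2) in c0 c1.
set v := z - _ in zs.
have zv : z - y = s *: xi + v.
  by rewrite [RHS]addrC /v opprD addrA subrK.
have ks : k * s <= s / 4 by rewrite mulrC ler_pM2l.
have nzy : enorm (z - y) <= s + enorm v.
  by rewrite zv (le_trans (enormD _ _)) // enormZ xi1 mulr1 gtr0_norm.
have h1 : - enorm v <= dotp xi v.
  by have := oppr_enorm_le_dotp xi v; rewrite xi1 mul1r.
apply/coneP; split; first lra.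
have xixi : dotp xi xi = 1 by rewrite -enorm_sqr xi1 expr1n.
rewrite -/c [in ltRHS]zv dotpDr dotpZr xixi mulr1.
have : c * enorm (z - y) <= c * (s + k * s).
  by rewrite ler_wpM2l // (le_trans nzy) // lerD2l ltW.
(* As [enorm v < k * s], the angle condition reduces to [k * (1 + c) <= 1 - c], which holds for
   [k = (1 - c) / 4] and [0 <= c < 1]. *)
have : (1 - c) * (1 - c) * s >= 0 by rewrite !mulr_ge0 // ?subr_ge0 ltW.
have -> : k = (1 - c) / 4 by [].
move: zs; have -> : k = (1 - c) / 4 by [].
by nra.
Qed.

(** Since [rho <= pi], the cosine is nonnegative, so [cos (rho / 2) * enorm (z - y) - dotp xi (z -
    y)] is convex in [z]; the cone is the part of a ball where it is negative. *)
Lemma cone_convex rho xi h y u v s : 0 < rho <= pi -> 0 < s <= 1 ->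
  cone rho xi h y u -> cone rho xi h y v ->
  cone rho xi h y ((1 - s) *: u + s *: v).
Proof.
move=> hrho /andP[s0 s1] /coneP[uh uc] /coneP[vh vc].
have /andP[c0 c1] := half_angle_cos hrho.
set c := cos (rho / 2) in uc vc c0 c1 *.
have E : (1 - s) *: u + s *: v - y = (1 - s) *: (u - y) + s *: (v - y).
  rewrite !scalerBr addrACA -opprD -scalerDl subrK scale1r //.
have nE : enorm ((1 - s) *: u + s *: v - y) <=
    (1 - s) * enorm (u - y) + s * enorm (v - y).
  by rewrite E (le_trans (enormD _ _)) // !enormZ !ger0_norm ?subr_ge0 // ltW.
have s1' : 0 <= 1 - s by rewrite subr_ge0.
apply/coneP; split.
  apply: (le_lt_trans nE).
  rewrite (_ : h = (1 - s) * h + s * h); last by ring.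
  by rewrite ler_ltD ?ltr_pM2l // ler_wpM2l // ltW.
rewrite -/c; apply: (@le_lt_trans _ _
    ((1 - s) * (c * enorm (u - y)) + s * (c * enorm (v - y)))).
  by rewrite !(mulrCA _ c) -mulrDr ler_wpM2l.
rewrite E dotpDr !dotpZr ler_ltD ?ltr_pM2l // ler_wpM2l // ltW //.
Qed.

(** The homothety of centre [x] and ratio [s] is applied to the ball inscribed around the axis point
    [p] at distance [h / 2] from the apex. Convexity keeps the image in the cone, and
    [enorm (p - x) < h / 2 + h]. *)
Lemma eball_sub_cone rho xi h y x s : 0 < rho <= pi -> 0 < h -> enorm xi = 1 ->
  cone rho xi h y x -> 0 < s <= 1 ->
  exists2 z, enorm (z - x) < s * (3 / 2 * h) &
    eball z (s * (cone_ratio rho * (h / 2))) `<=` cone rho xi h y.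
Proof.
move=> hrho h0 xi1 yx s01; have /andP[s0 s1] := s01.
pose p := y + (h / 2) *: xi; exists ((1 - s) *: x + s *: p).
  have -> : (1 - s) *: x + s *: p - x = s *: (p - x).
    by rewrite scalerBl scale1r scalerBr addrC !addrA addNr add0r addrC.
  rewrite enormZ gtr0_norm // ltr_pM2l //.
  have /coneP[xh _] := yx; apply: (le_lt_trans (enorm_triangle _ y _)).
  rewrite {1}/p (addrC y) addrK enormZ xi1 (enormB y) gtr0_norm ?divr_gt0 //.
  lra.
move=> w; rewrite /eball /= => ws.
have -> : w = (1 - s) *: x + s *: (p + s^-1 *: (w - ((1 - s) *: x + s *: p))).
  by rewrite scalerDr scalerA divff ?gt_eqF // scale1r addrA addrC subrK.
apply: cone_convex => //.
apply: (@axis_eball_sub_cone _ _ _ _ (h / 2)) => //.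
  by rewrite lexx andbT divr_gt0.
rewrite /eball /= -/p (addrC p) addrK enormZ gtr0_norm ?invr_gt0 //.
by rewrite mulrC ltr_pdivrMr // mulrC.
Qed.

Lemma continuous_enormB x : continuous (fun y => enorm (y - x)).
Proof.
move=> y; apply/(@cvgrPdist_lt _ _ _ _ (nbhs_filter y)) => e e0.
near=> z; have : eball y e z.
  near: z; apply: open_nbhs_nbhs; split; first exact: open_eball.
  exact: eball_center.
rewrite /eball /=; apply: le_lt_trans.
rewrite ler_norml; have := enorm_triangle y z x; have := enorm_triangle z y x.
by rewrite (enormB y z) => ? ?; apply/andP; split; lra.
Unshelve. all: by end_near. Qed.

(** Compactness gives a nearest point; were it interior, a small move towards [x] would stay in [B]
    and come closer. *)
Lemma nearest_boundary B x : B !=set0 -> compact B -> ~ B x ->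
  exists2 y, boundary B y & forall z, B z -> enorm (y - x) <= enorm (z - x).
Proof.
move=> B0 cB Bx.
have [y yB ymin] := EVT_min_rV B0 cB
  (continuous_subspaceT (@continuous_enormB x)).
rewrite inE in yB; have {}ymin z : B z -> enorm (y - x) <= enorm (z - x).
  by move=> Bz; apply: ymin; rewrite inE.
exists y => //; split; first exact: subset_closure.
move=> By; have [r r0 rB] := (open_eballP _).1 (open_interior B) _ By.
pose D := enorm (y - x).
have D0 : 0 < D.
  rewrite lt_def enorm_ge0 andbT; apply/negP => /eqP/enorm_eq0/subr0_eq yx.
  by apply: Bx; rewrite -yx.
have rD : 0 < r + D by rewrite addr_gt0.
(* A move of length [u * D < r] stays in the ball, and the distance to [x] drops to
   [(1 - u) * D]. *)
pose u := r / (r + D).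
have u0 : 0 < u by rewrite divr_gt0.
have u1 : u <= 1 by rewrite ler_pdivrMr // mul1r lerDl ltW.
have := ymin (y - u *: (y - x)).
have -> : y - u *: (y - x) - x = (1 - u) *: (y - x).
  by rewrite scalerBl scale1r addrAC.
rewrite enormZ ger0_norm ?subr_ge0 // -/D => H.
have : D <= (1 - u) * D.
  apply: H; apply: interior_subset; apply: rB.
  rewrite /eball /= addrAC subrr add0r enormN enormZ gtr0_norm // -/D.
  by rewrite /u mulrAC ltr_pdivrMr // ltr_pM2l // ltrDr.
by have := mulr_gt0 u0 D0; lra.
Qed.

Lemma cone_hull_inner rho h S A e : 0 < rho <= pi -> 0 < e ->
  2 * e <= cone_ratio rho * h ->
  (forall x, S x -> exists2 a, A a & eball x e a) ->
  inner_parallel S (4 * e / cone_ratio rho) `<=` cone_hull rho h A.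
Proof.
move=> hrho e0 eh SA x [Sx xS] B [[B0 cB conB] AB].
have /andP[k0 k1] := cone_ratio_bounds hrho.
set k := cone_ratio rho in k0 k1 eh xS *.
apply: contrapT => Bx.
have [y bBy ymin] := nearest_boundary B0 cB Bx.
have [xi [xi1 xiB]] := conB _ bBy.
have [a Aa xa] := SA _ Sx.
(* The sample point near [x] lies in [B], so the nearest point [y] of [B] is no farther from [x]. *)
have yx : enorm (y - x) < e by apply: le_lt_trans xa; apply: ymin; exact: AB.
(* At distance [e / k] from the apex, the ball inscribed around the axis has radius exactly [e]. *)
have s0 : 0 < e / k by rewrite divr_gt0.
have ks : e / k <= h / 2 by rewrite ler_pdivrMr //; lra.
have := @axis_eball_sub_cone rho xi h y (e / k) hrho xi1.
rewrite s0 ks -/k mulrCA divff ?gt_eqF // mulr1 => /(_ isT) sub.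
(* From [k <= 1 / 4]; hence the centre is within [e + e / k < 4 * e / k] of [x] and lies in [S]. *)
have kk : e <= e / k / 4.
  rewrite ler_pdivlMr // ler_pdivlMr // -mulrA ger_pMr //.
  by move: k1; rewrite -[4^-1]mul1r ler_pdivlMr // mulrC.
have [|a' Aa' ya'] := SA (y + (e / k) *: xi).
  apply: xS; rewrite /eball /= -addrA (addrC (_ *: _)) addrA.
  apply: (le_lt_trans (enormD _ _)); rewrite enormZ xi1 mulr1 gtr0_norm //.
  by rewrite -(mulrA 4); move: s0 kk; set q := e / k; lra.
by apply: xiB (sub _ ya') (AB _ Aa').
Qed.

Lemma ccone_hull_inner rho h S A e : 0 < rho <= pi -> 0 < h -> 0 < e ->
  2 * e <= cone_ratio rho * h ->
  (forall x, S x -> exists2 a, A a & eball x e a) ->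
  inner_parallel S (4 * e / cone_ratio rho) `<=` ccone_hull rho h A.
Proof.
move=> hrho h0 e0 eh SA x [Sx xS] [y xi] /= [xi1 conA] yx.
have /andP[k0 k1] := cone_ratio_bounds hrho.
set k := cone_ratio rho in k0 k1 eh xS *.
have kh0 : 0 < k * h by rewrite mulr_gt0.
(* This ratio gives the contracted ball radius [e], with centre within [3 * e / k] of [x], below the
   inner parallel distance [4 * e / k]. *)
have s01 : 0 < 2 * e / (k * h) <= 1.
  apply/andP; split; first by rewrite divr_gt0 // mulr_gt0.
  by rewrite ler_pdivrMr // mul1r.
have [z zx zC] := eball_sub_cone hrho h0 xi1 yx s01.
have E1 : 2 * e / (k * h) * (cone_ratio rho * (h / 2)) = e.
  by rewrite -/k; field; rewrite !gt_eqF.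
have E2 : 2 * e / (k * h) * (3 / 2 * h) = 3 * e / k.
  by field; rewrite !gt_eqF.
rewrite E1 in zC; rewrite E2 in zx.
have [|a Aa za] := SA z.
  apply: xS; apply: (lt_le_trans zx); rewrite ler_pM2r ?invr_gt0 //; lra.
by have : set0 a by rewrite -conA; split=> //; exact: zC.
Qed.

End Cones.

(** * Borel measurability and the support of a measure *)

Section BorelMeasure.
Context {R : realType} {d : nat}.
Implicit Types (x y : 'rV[R]_d) (A S U : set 'rV[R]_d) (e : R).

Lemma borel_open U : open U -> measurable (U : set (borel_rV R d)).
Proof. by move=> oU; exact: sub_sigma_algebra. Qed.

Lemma borel_closed A : closed A -> measurable (A : set (borel_rV R d)).
Proof.
move=> cA; rewrite -(setCK A); apply: measurableC; apply: borel_open.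
exact: closed_openC.
Qed.

Lemma closed_eballCP A :
  closed A <-> forall x, ~ A x -> exists2 r, 0 < r & eball x r `<=` ~` A.
Proof.
split=> [cA|HA]; first exact: (open_eballP _).1 (closed_openC cA).
by rewrite -(setCK A); apply: open_closedC; apply/open_eballP.
Qed.

Lemma closed_inner_parallel S e : closed S -> closed (inner_parallel S e).
Proof.
move=> cS; apply/closed_eballCP => x /not_andP[Sx|].
  have [r r0 rS] := (closed_eballCP _).1 cS x Sx.
  by exists r => // z /rS Sz [].
move=> /existsNP[z /not_implyP[xz Sz]]; exists (e - enorm (z - x)).
  by rewrite subr_gt0.
move=> w; rewrite /eball /= ltrBrDl => xw [_ /(_ z)]; apply: contra_not Sz.
apply; rewrite /eball /= (le_lt_trans _ xw) //.
by rewrite (enormB w) enorm_triangle.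
Qed.

Lemma closed_cone_hull rho h A : closed (cone_hull rho h A).
Proof.
by apply: closed_bigI => B [[_ cB _] _]; exact: compact_closed.
Qed.

Lemma closed_ccone_hull rho h A : closed (ccone_hull rho h A).
Proof. by apply: closed_bigI => p _; apply: open_closedC; exact: open_cone. Qed.

Lemma exists_rat_eball x e : 0 < e ->
  exists q : 'rV[rat]_d, eball x e (map_mx ratr q).
Proof.
move=> e0; have e'0 : 0 < e / d.+1%:R by rewrite divr_gt0.
have qP i : exists q : rat, x ord0 i < ratr q < x ord0 i + e / d.+1%:R.
  have xx : x ord0 i < x ord0 i + e / d.+1%:R by rewrite ltrDl.
  by have [r] := rat_in_itvoo xx; rewrite in_itv /= => rP; exists r.
pose q := \row_i sval (cid (qP i)); exists q; rewrite /eball /=.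
apply: (@le_lt_trans _ _ (d%:R * (e / d.+1%:R))).
  apply: enorm_le_coord => [i|]; last exact: ltW.
  rewrite !mxE; case: cid => /= r /andP[r1 r2].
  by rewrite gtr0_norm ?subr_gt0 // ltW // ltrBlDl.
by rewrite mulrCA gtr_pMr // ltr_pdivrMr ?mul1r ?ltr_nat.
Qed.

Variable nu : {measure set (borel_rV R d) -> \bar R}.

(** A point outside the support has a null open neighbourhood, hence lies in a null ball with
    rational centre and radius [1 / (k + 1)]; there are countably many such balls. *)
Lemma msupportC_negligible : nu.-negligible (~` msupport nu).
Proof.
pose B (p : 'rV[rat]_d * nat) : set (borel_rV R d) :=
  eball (map_mx ratr p.1) (p.2.+1%:R)^-1.
pose F n := if (@unpickle ('rV[rat]_d * nat)%type n) is Some p then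
  if nu (B p) == 0%E then B p else set0 else set0.
apply: (@negligibleS _ _ _ nu (\bigcup_n F n)); last first.
  apply: negligible_bigcup => n; rewrite /F.
  case: unpickle => [p|]; last exact: negligible_set0.
  case: eqP => [Bp|_]; last exact: negligible_set0.
  by apply/negligibleP => //; apply: borel_open; exact: open_eball.
move=> x /existsNP[U /not_implyP[oU /not_implyP[Ux U0]]].
have {}U0 : nu U = 0%E.
  by apply/eqP; rewrite eq_le measure_ge0 andbT leNgt; exact/negP.
have [r r0 rU] := (open_eballP _).1 oU _ Ux.
have r20 : 0 < r / 2 by rewrite divr_gt0.
(* The centre [q] will be within [1 / (k + 1)] of [x], so the ball of that radius around [q]
   contains [x] and stays within [r] of it. *)
have [k kr] : exists k : nat, (k.+1%:R)^-1 < r / 2.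
  exists (Num.truncn (r / 2)^-1).
  by rewrite invf_plt ?posrE // truncnS_gt.
have k1 : 0 < (k.+1%:R)^-1 :> R by rewrite invr_gt0.
have [q xq] := exists_rat_eball x k1.
exists (pickle (q, k)) => //; rewrite /F pickleK.
have Br : B (q, k) `<=` U.
  move=> z; rewrite /B /eball /= => zq; apply: rU.
  move: xq; rewrite /eball /= => xq.
  apply: (le_lt_trans (enorm_triangle z (map_mx ratr q) x)).
  by apply: (lt_trans (ltrD zq xq)); rewrite (splitr r) ltrD.
have mB : measurable (B (q, k)) by apply: borel_open; exact: open_eball.
have -> : nu (B (q, k)) = 0%E.
  apply/eqP; rewrite eq_le measure_ge0 andbT -U0.
  by apply: le_measure => //; rewrite inE //; exact: borel_open.
by rewrite eqxx /B /eball /= enormB.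
Qed.

End BorelMeasure.

(** * Lower bounds for the mass of small balls *)

Section LebesgueLowerBound.
Context {R : realType}.

(* Unlike ge0_le_integral, no measurability is needed: the integral of a
   nonnegative function is a supremum over simple functions below it. *)
Lemma ge0_le_integralT disp (T : measurableType disp)
    (mu : {measure set T -> \bar R}) (f g : T -> \bar R) :
  (forall x, 0 <= f x)%E -> (forall x, f x <= g x)%E ->
  (\int[mu]_(x in [set: T]) f x <= \int[mu]_(x in [set: T]) g x)%E.
Proof.
move=> f0 fg; rewrite !ge0_integralTE // => [|x]; last exact: le_trans (fg x).
apply: ereal_sup_le => _ [k /= kf <-]; exists k => // x.
exact: le_trans (fg x).
Qed.

Lemma lebesgue_rV_ge0 d (A : set 'rV[R]_d) : (0 <= lebesgue_rV A)%E.
Proof.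
by elim: d A => [|d IH] A /=; [rewrite lee_fin | apply: integral_ge0].
Qed.

Lemma le_lebesgue_rV d (A B : set 'rV[R]_d) : A `<=` B ->
  (lebesgue_rV A <= lebesgue_rV B)%E.
Proof.
elim: d A B => [|d IH] A B AB /=.
  rewrite lee_fin !indicE ler_nat.
  by case: (boolP (0 \in A)) => // /set_mem/AB/mem_set ->.
apply: ge0_le_integralT => t; first exact: lebesgue_rV_ge0.
by apply: IH => v; exact: AB.
Qed.

(** The bound is the volume of an inscribed cube: its half-side [e / d.+1] puts its points at
    distance at most [d * e / d.+1 < e] from [x]. *)
Lemma lebesgue_rV_eball_ge d (x : 'rV[R]_d) (e : R) : 0 < e ->
  (((2 / d.+1%:R * e) ^+ d)%:E <= lebesgue_rV (eball x e))%E.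
Proof.
move=> e0; pose r := e / d.+1%:R; have r0 : 0 < r by rewrite divr_gt0.
pose a := \row_i (x ord0 i - r); pose b := \row_i (x ord0 i + r).
have ab i : a ord0 i <= b ord0 i by rewrite !mxE; lra.
have -> : (2 / d.+1%:R * e) ^+ d = \prod_i (b ord0 i - a ord0 i).
  rewrite (eq_bigr (fun=> 2 / d.+1%:R * e)) ?prodr_const ?card_ord // => i _.
  by rewrite !mxE /r; field; rewrite ?nat1r ?natr1 pnatr_eq0.
rewrite -lebesgue_rV_box //; apply: le_lebesgue_rV => v /= vab.
rewrite /eball /=; apply: (@le_lt_trans _ _ (d%:R * r)).
  apply: enorm_le_coord => [i|]; last exact: ltW.
  by have := vab i; rewrite !mxE ler_norml; lra.
by rewrite mulrCA gtr_pMr // ltr_pdivrMr ?mul1r ?ltr_nat.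
Qed.

Lemma standard_eball_ge d (nu : {measure set (borel_rV R d) -> \bar R})
    (S : set 'rV[R]_d) : closed S -> standard nu S ->
  exists lam c : R, [/\ 0 < lam, 0 < c & forall x e, S x -> 0 < e <= lam ->
    ((c * e ^+ d)%:E <= nu (eball x e))%E].
Proof.
move=> cS [lam [delta [lam0 delta0 H]]].
exists lam, (delta * (2 / d.+1%:R) ^+ d); split => //.
  by rewrite mulr_gt0 // exprn_gt0 // divr_gt0.
move=> x e Sx /[dup] elam /andP[e0 _].
apply: (@le_trans _ _ (nu (eball x e `&` S))).
  apply: le_trans (H x e Sx elam).
  rewrite -mulrA -exprMn EFinM.
  by apply: lee_wpmul2l; [rewrite lee_fin ltW | exact: lebesgue_rV_eball_ge].
have mb : measurable (eball x e : set (borel_rV R d)).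
  by apply: borel_open; exact: open_eball.
apply: le_measure; rewrite ?inE //; apply: measurableI => //.
exact: borel_closed.
Qed.

End LebesgueLowerBound.

(** * Packings and finite nets *)

Section Packing.
Context {R : realType} {d : nat}.
Implicit Types (x y : 'rV[R]_d) (S : set 'rV[R]_d) (e p : R) (s : seq 'rV[R]_d).

Definition separated e s :=
  forall i j, (i < j < size s)%N -> e <= enorm (s`_i - s`_j).

Lemma separated_cons e x s : separated e s ->
  (forall y, y \in s -> e <= enorm (x - y)) -> separated e (x :: s).
Proof.
move=> ss xs [|i] [|j] //=; rewrite ltnS => H.
  by apply: xs; exact: mem_nth.
by apply: ss; rewrite -ltnS.
Qed.

(* Balls of radius [e] around a [2 * e]-separated sequence are disjoint. *)
Lemma separated_size (nu : probability (borel_rV R d) R) S e p s : 0 < e ->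
  (forall x, S x -> p%:E <= nu (eball x e))%E ->
  separated (e + e) s -> (forall x, x \in s -> S x) -> (size s)%:R * p <= 1.
Proof.
move=> e0 Sp ss sS.
pose F (i : 'I_(size s)) : set (borel_rV R d) := eball s`_i e.
have mF i : measurable (F i) by apply: borel_open; exact: open_eball.
have tF : trivIset setT F.
  have dis (i j : 'I_(size s)) : (i < j)%N -> F i `&` F j !=set0 -> False.
    move=> ij [z [iz jz]].
    have /ss : (i < j < size s)%N by rewrite ij /=.
    apply/negP; rewrite -ltNge (le_lt_trans (enorm_triangle _ z _)) //.
    by rewrite ltrD // enormB.
  move=> i j _ _ Fij; apply/val_inj => /=; case: (ltngtP i j) => // ij; exfalso.
    exact: dis ij Fij.
  by apply: dis ij _; rewrite setIC.
have : (nu (\big[setU/set0]_(i < size s) F i) <= 1)%E.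
  by apply: probability_le1; apply: bigsetU_measurable => i _; exact: mF.
rewrite (measure_bigsetU_ord _ _ mF tF) => H.
rewrite -lee_fin (le_trans _ H) //.
apply: (@le_trans _ _ (\sum_(i < size s) p%:E)%E).
  by rewrite sumEFin sumr_const card_ord mulr_natl lexx.
by apply: lee_sum => i _; apply: Sp; apply: sS; exact: mem_nth.
Qed.

(** Greedy construction: a separated sequence that is not a net can be extended by an uncovered
    point, so without a net there would be separated sequences of every length, against
    [separated_size]. *)
Lemma exists_finite_net (nu : probability (borel_rV R d) R) S e p :
  0 < e -> 0 < p -> (forall x, S x -> p%:E <= nu (eball x e))%E ->
  exists s, [/\ (forall x, x \in s -> S x), (size s)%:R * p <= 1 &
    forall x, S x -> exists2 y, y \in s & eball x (e + e) y].
Proof.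
move=> e0 p0 Sp; apply: contrapT => noS.
have sep n : exists s, [/\ size s = n, separated (e + e) s &
    forall x, x \in s -> S x].
  elim: n => [|n [s [sn ss sS]]]; first by exists [::]; split=> // i j /andP[].
  have [x Sx xs] : exists2 x, S x & forall y, y \in s -> e + e <= enorm (x - y).
    apply: contrapT => nox; apply: noS; exists s; split=> //.
      exact: (separated_size e0 Sp ss sS).
    move=> x Sx; apply: contrapT => noy; apply: nox; exists x => // y ys.
    rewrite leNgt; apply/negP => xy; apply: noy; exists y => //.
    by rewrite /eball /= enormB.
  exists (x :: s); split; [by rewrite /= sn | exact: separated_cons |].
  by move=> y; rewrite inE => /predU1P[->|/sS].
have [s [sn ss sS]] := sep (Num.truncn p^-1).+1.
have := separated_size e0 Sp ss sS; rewrite sn; apply/negP; rewrite -ltNge.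
by rewrite -ltr_pdivrMr // mul1r truncnS_gt.
Qed.

End Packing.

(** * Probability that the sample misses a ball of the net *)

Section Sampling.
Context {R : realType} {d : nat} {disp : measure_display}.
Context {Omega : measurableType disp} {P : probability Omega R}.
Context {PX : probability (borel_rV R d) R}.
Context {X : nat -> {RV P >-> borel_rV R d}}.
Context (iidX : iid_sample X PX).
Implicit Types (x y : 'rV[R]_d) (S B : set 'rV[R]_d) (e p : R).

Definition missed B n : set Omega := \bigcap_(i in `I_n) X i @^-1` ~` B.

Lemma measurable_RV_preimage i (A : set (borel_rV R d)) :
  measurable A -> measurable (X i @^-1` A).
Proof. by move=> mA; rewrite -[_ @^-1` _]setTI; exact: measurable_funPT. Qed.

Lemma measurable_missed (B : set (borel_rV R d)) n :
  measurable B -> measurable (missed B n).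
Proof.
move=> mB; apply: bigcap_measurableType => i _; apply: measurable_RV_preimage.
exact: measurableC.
Qed.

Lemma missed_prob (B : set (borel_rV R d)) n : measurable B ->
  P (missed B n) = ((1 - fine (PX B)) ^+ n)%:E.
Proof.
move=> mB; have mBC : measurable (~` B) by exact: measurableC.
have -> : missed B n = \bigcap_(i in [set` iota 0 n]) (X i @^-1` ~` B).
  rewrite /missed (_ : `I_n = [set` iota 0 n]) //.
  by apply/seteqP; split=> i /=; rewrite mem_iota.
have [ind dist] := iidX.
rewrite (ind (iota 0 n) (fun=> ~` B)) ?iota_uniq //.
have E i : P (X i @^-1` ~` B) = (1 - fine (PX B))%:E.
  have := dist i (~` B) mBC; rewrite /distribution /pushforward => ->.
  rewrite probability_setC // EFinB fineK // fin_num_measure //.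
under eq_bigr do rewrite E.
by rewrite prodEFin big_const_seq count_predT size_iota iter_mulr_1.
Qed.

Lemma missed_prob_le (B : set (borel_rV R d)) n p : measurable B ->
  (p%:E <= PX B)%E -> (P (missed B n) <= (expR (- (n%:R * p)))%:E)%E.
Proof.
move=> mB pB; rewrite missed_prob // lee_fin -mulrN expRM_natl.
have fB : PX B \is a fin_num by exact: fin_num_measure.
have B1 : fine (PX B) <= 1 by rewrite -lee_fin fineK // probability_le1.
have pB' : p <= fine (PX B) by rewrite -lee_fin fineK.
rewrite lerXn2r ?nnegrE ?expR_ge0 ?subr_ge0 //.
by apply: (le_trans _ (expR_ge1Dx _)); rewrite lerD2l lerN2.
Qed.

(** [E] is the event that some ball around a point of a net is missed; the net has at most [p^-1]
    points. Off [E], a point of [S] is within [2 * e] of a net point, itself within [e] of an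
    observation. *)
Lemma exists_uncovered_event S e p n : 0 < e -> 0 < p ->
  (forall x, S x -> p%:E <= PX (eball x e))%E ->
  exists E : set Omega, [/\ measurable E,
    (P E <= (p^-1 * expR (- (n%:R * p)))%:E)%E &
    forall w, ~ E w -> forall x, S x ->
      exists2 a, sample_set X n w a & eball x (e + e + e) a].
Proof.
move=> e0 p0 Sp; have [s [sS sp net]] := exists_finite_net e0 p0 Sp.
have mb x : measurable (eball x e : set (borel_rV R d)).
  by apply: borel_open; exact: open_eball.
pose F i := missed (eball s`_i e) n.
have mF i : measurable (F i) by apply: measurable_missed.
exists (\big[setU/set0]_(i < size s) F i); split.
- exact: bigsetU_measurable.
- apply: le_trans (Boole_inequality _ _) _ => //.
  apply: (@le_trans _ _ (\sum_(i < size s) (expR (- (n%:R * p)))%:E)%E).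
    apply: lee_sum => i _; apply: missed_prob_le => //.
    by apply: Sp; apply: sS; exact: mem_nth.
  rewrite sumEFin sumr_const card_ord lee_fin -[leLHS]mulr_natl.
  by rewrite ler_wpM2r ?expR_ge0 // -[p^-1]mul1r ler_pdivlMr.
- move=> w nF x Sx; have [y ys xy] := net _ Sx.
  have [a aS ya] : exists2 a, sample_set X n w a & eball y e a.
    apply: contrapT => noa; apply: nF.
    rewrite -bigcup_mkord; exists (index y s); first by rewrite /= index_mem.
    move=> i /= ilt; rewrite /F nth_index // => yX.
    by apply: noa; exists (X i w) => //; exists i.
  exists a => //; apply: (le_lt_trans (enorm_triangle _ y _)).
  by rewrite addrC; apply: ltrD.
Qed.

End Sampling.

(** * Estimates for the rate and a summability criterion *)

Section LogRate.
Context {R : realType}.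
Implicit Types (eta : R).

Lemma log_rateX d n : (0 < d)%N -> (0 < n)%N ->
  log_rate d n ^+ d = ln n%:R / n%:R :> R.
Proof.
move=> d0 n0; rewrite /log_rate -powR_mulrn ?powR_ge0 // -powRrM mulVf.
  by rewrite powRr1 // divr_ge0 // ln_ge0 // ler1n.
by rewrite pnatr_eq0 -lt0n.
Qed.

Lemma log_rate_gt0 d n : (1 < n)%N -> 0 < log_rate d n :> R.
Proof.
move=> n1; apply: powR_gt0; rewrite divr_gt0 ?ln_gt0 ?ltr1n //.
by rewrite ltr0n ltnW.
Qed.

Lemma ln_le_self (x : R) : 0 < x -> ln x <= x.
Proof.
move=> x0; have x1 : -1 < x - 1 by rewrite ltrBrDr addNr.
by have := le_ln1Dx x1; rewrite addrC subrK; lra.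
Qed.

Lemma ln2_ge : 1 <= 3 * ln 2 :> R.
Proof.
have := @le_ln1Dx R (- 2^-1); rewrite ltrN2 invf_lt1 // ltr1n => /(_ isT).
have -> : 1 - 2^-1 = 2^-1 :> R by field.
by rewrite lnV ?posrE //; lra.
Qed.

Lemma log_rate_small d eta : (0 < d)%N -> 0 < eta ->
  exists m, forall n, (m <= n)%N -> log_rate d n <= eta.
Proof.
move=> d0 eta0; pose D := eta ^+ d; have D0 : 0 < D by rewrite exprn_gt0.
(* For [n > M ^+ 2], [ln n = ln (n / M) + ln M <= n / M + M <= 2 * n / M = D * n]. *)
pose M := 2 / D; have M0 : 0 < M by rewrite divr_gt0.
exists (Num.truncn (M ^+ 2)).+1 => n mn.
have nM : M ^+ 2 < n%:R.
  by apply: (lt_le_trans (truncnS_gt _)); rewrite ler_nat.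
have n0 : 0 < n%:R :> R by apply: lt_trans nM; rewrite exprn_gt0.
have n0' : (0 < n)%N by rewrite -(ltr0n R).
rewrite -(ler_pXn2r d0) ?nnegrE ?powR_ge0 ?(ltW eta0) // log_rateX //.
rewrite ler_pdivrMr // -/D.
have nM0 : 0 < n%:R / M by rewrite divr_gt0.
have -> : n%:R = n%:R / M * M by rewrite divfK // gt_eqF.
rewrite lnM ?posrE //.
apply: (le_trans (lerD (ln_le_self nM0) (ln_le_self M0))).
have -> : D = 2 / M by rewrite /M invf_div mulrCA divff ?mulr1 // gt_eqF.
have -> : 2 / M * (n%:R / M * M) = 2 * (n%:R / M).
  by rewrite mulrAC mulrA divfK ?gt_eqF // mulrC mulrAC.
have : M <= n%:R / M by rewrite ler_pdivlMr // -expr2 ltW.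
by lra.
Qed.

Lemma nneseries_lty_invX2 (u : nat -> \bar R) : (forall n, 0 <= u n)%E ->
  (forall n, u n <= ((n%:R^-1) ^+ 2)%:E)%E -> (\sum_(n <oo) u n < +oo)%E.
Proof.
move=> u0 uB; apply: (@le_lt_trans _ _ 4%:E); last exact: ltry.
apply: lime_le; first by apply: is_cvg_nneseries.
apply: nearW => -[|N]; first by rewrite big_geq // lee_fin.
(* Strengthened for induction: [1 / x ^+ 2 <= 2 / x - 2 / (x + 1)] for [x >= 1] telescopes. The term
   of index 0 vanishes because [0^-1 = 0]. *)
apply: (@le_trans _ _ (4 - 2 / N.+1%:R)%:E); last first.
  by rewrite lee_fin gerBl divr_ge0.
elim: N => [|N IH].
  rewrite big_nat1 (le_trans (uB 0)) // lee_fin.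
  by rewrite mulr0n invr0 mulr1n invr1 expr0n /=; lra.
rewrite big_nat_recr //= (le_trans (leeD IH (uB _))) // -EFinD lee_fin.
rewrite -[N.+2%:R]natr1; set x : R := N.+1%:R.
have x1 : 1 <= x by rewrite ler1n.
have x0 : 0 < x by exact: lt_le_trans x1.
have x10 : 0 < x + 1 by rewrite addr_gt0.
have -> : 2 / (x + 1) = 2 / x - 2 / (x * (x + 1)).
  by field; rewrite !gt_eqF.
have : x ^- 2 <= 2 / (x * (x + 1)).
  rewrite ler_pdivlMr; last exact: mulr_gt0.
  rewrite mulrC ler_pdivrMr; last exact: exprn_gt0.
  by nra.
by rewrite exprVn opprB -addrA lerD2l addrC lerD2r.
Qed.

End LogRate.

(** * Almost sure covering of the support by the sample *)

Section Covering.
Context {R : realType} {d : nat} {disp : measure_display}.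
Context {Omega : measurableType disp} {P : probability Omega R}.
Context {PX : probability (borel_rV R d) R}.
Context {X : nat -> {RV P >-> borel_rV R d}}.

(* With c * e_n^d = 3 * ln n / n, a ball of radius e_n around a point of S is
   missed by n observations with probability at most n^-3, and the net has at
   most n points, so the uncovered events have summable probability. *)
Lemma sample_covers_ae (S : set 'rV[R]_d) : iid_sample X PX -> (0 < d)%N ->
  closed S -> standard PX S -> exists2 K : R, 0 < K &
  {ae P, forall w, exists m, forall n, (m <= n)%N -> forall x, S x ->
    exists2 a, sample_set X n w a & eball x (K * log_rate d n) a}.
Proof.
move=> iidX d0 cS /(standard_eball_ge cS)[lam [c [lam0 c0 Sc]]].
pose K := (3 / c) `^ d%:R^-1; have K0 : 0 < K by rewrite powR_gt0 // divr_gt0.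
have KX : K ^+ d = 3 / c.
  rewrite -powR_mulrn ?powR_ge0 // -powRrM mulVf ?powRr1 ?divr_ge0 // ?ltW //.
  by rewrite pnatr_eq0 -lt0n.
have [m0 m0P] := log_rate_small d0 (divr_gt0 lam0 K0).
pose N := maxn m0 2.
have EX n : exists E : set Omega, [/\ measurable E,
    (P E <= ((n%:R^-1) ^+ 2)%:E)%E &
    (N <= n)%N -> forall w, ~ E w -> forall x, S x ->
      exists2 a, sample_set X n w a & eball x (3 * K * log_rate d n) a].
  (* Below [N] the empty event serves, so that [choice] yields a family over all [n]; from [N] on
     the rate is positive and [e <= lam]. *)
  have [Nn|nN] := leqP N n; last first.
    exists set0; split=> //.
    by rewrite measure0 lee_fin exprn_ge0.
  have [m0n n2] : (m0 <= n)%N /\ (2 <= n)%N.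
    by split; apply: leq_trans Nn; rewrite /N leq_max leqnn ?orbT.
  have n0 : 0 < n%:R :> R by rewrite ltr0n ltnW.
  pose e := K * log_rate d n.
  have e0 : 0 < e by rewrite mulr_gt0 // log_rate_gt0.
  have elam : e <= lam by rewrite /e mulrC -ler_pdivlMr // m0P.
  pose p := c * e ^+ d.
  have pE : n%:R * p = 3 * ln n%:R.
    rewrite /p /e exprMn KX log_rateX //; last exact: ltnW.
    by field; rewrite !gt_eqF.
  have p0 : 0 < p by rewrite mulr_gt0 // exprn_gt0.
  have [|E [mE PE HE]] :=
      @exists_uncovered_event _ _ _ _ P PX X iidX S e p n e0 p0.
    by move=> x Sx; apply: Sc => //; rewrite e0 elam.
  exists E; split=> //; last first.
    move=> _ w Ew x Sx; have [a aS xa] := HE w Ew x Sx; exists a => //.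
    suff <- : e + e + e = 3 * K * log_rate d n by [].
    by rewrite /e; ring.
  apply: le_trans PE _; rewrite lee_fin pE.
  have -> : expR (- (3 * ln n%:R)) = n%:R^-1 ^+ 3 :> R.
    by rewrite expRN expRM_natl lnK ?posrE // exprVn.
  (* One factor [n^-1] of the cube absorbs [p^-1], because [n * p = 3 * ln n >= 3 * ln 2 >= 1]. *)
  rewrite exprS mulrA ler_piMl ?exprn_ge0 ?invr_ge0 ?(ltW n0) //.
  have np0 : 0 < n%:R * p by rewrite mulr_gt0.
  rewrite -invfM (mulrC p) invf_le1 // pE (le_trans ln2_ge) //.
  by rewrite ler_pM2l // ler_ln ?posrE // ler_nat.
have [F FP] := choice EX; exists (3 * K); first by rewrite mulr_gt0.
exists (lim_sup_set F); split.
- apply: bigcap_measurableType => k _; apply: bigcup_measurable => n _.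
  by have [] := FP n.
- apply: lim_sup_set_cvg0 => [n|]; first by have [] := FP n.
  by apply: nneseries_lty_invX2 => n //; have [] := FP n.
- move=> w /= H k _; apply: contrapT => nF; apply: H.
  exists (maxn N k) => n; rewrite geq_max => /andP[Nn kn].
  have [_ _ /(_ Nn w)] := FP n; apply => Fw; apply: nF.
  by exists n.
Qed.

(** Each observation avoids the [PX]-null complement of the support almost surely, and there are
    countably many observations. *)
Lemma sample_sub_support_ae : iid_sample X PX -> closed (msupport PX) ->
  {ae P, forall w n, sample_set X n w `<=` msupport PX}.
Proof.
move=> iidX cS.
have mC : measurable (~` msupport PX : set (borel_rV R d)).
  by apply: measurableC; exact: borel_closed.
have H : {ae P, forall w i, msupport PX (X i w)}.
  apply: ae_foralln => i; exists (X i @^-1` ~` msupport PX); split.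
  - exact: measurable_RV_preimage.
  - rewrite -[LHS]/(distribution P (X i) _) (iidX.2 i _ mC).
    by apply/negligibleP => //; exact: msupportC_negligible.
  - by [].
by apply: filterS H => w Hw n _ [i _ <-].
Qed.

End Covering.

(** * From covering to the rate of the distance in measure *)

Section Rate.
Context {R : realType} {d : nat} {disp : measure_display}.
Context {Omega : measurableType disp} {P : probability Omega R}.
Context {PX : probability (borel_rV R d) R}.

(** As [H n w] lies in [S], only the mass of [S] outside it counts; it is at most the mass outside
    the inner parallel set, hence at most [C * (k * L)] with [L] the rate. The upper limit is thus
    at most [C * k]. *)
Lemma as_bigO_dmeas (S : set 'rV[R]_d) (H : nat -> Omega -> set 'rV[R]_d)
    (k : R) :
  (0 < d)%N -> closed S -> (forall n w, closed (H n w)) -> 0 < k ->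
  (fun t : R => fine (PX (S `\` inner_parallel S t))) =O_ (0^'+)
    (fun t : R => t) ->
  {ae P, forall w n, H n w `<=` S} ->
  {ae P, forall w, exists m, forall n, (m <= n)%N ->
    inner_parallel S (k * log_rate d n) `<=` H n w} ->
  as_bigO P (fun n w => dmeas PX (H n w) S) (log_rate d).
Proof.
move=> d0 cS cH k0 /eqO_exP[C C0 /nbhs_ballP[r /= r0 rP]] HS SH.
(* The half gives the strict inequality [k * L < r], so the assumed bound applies at [t = k * L]. *)
have [m0 m0P] := log_rate_small d0 (divr_gt0 (divr_gt0 r0 k0) (ltr0n R 2)).
apply: filterS2 HS SH => w HSw [m mP].
apply: (@le_lt_trans _ _ (C * k)%:E); last exact: ltry.
pose N := maxn m (maxn m0 2).
(* The upper limit is at most the supremum over any tail. *)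
apply: (@le_trans _ _ (ereal_sup [set (`|dmeas PX (H n w) S| *
    ((log_rate d n)^-1)%:E)%E | n in [set n | (N <= n)%N]])).
  by apply: ereal_inf_lbound; exists [set n | (N <= n)%N] => //; exists N.
apply: ge_ereal_sup => _ [n /= Nn <-].
move: Nn; rewrite !geq_max => /andP[mn /andP[m0n n2]].
have L0 := @log_rate_gt0 R d n n2; set L := log_rate d n in L0 *.
have kL0 : 0 < k * L by rewrite mulr_gt0.
have mb (A : set 'rV[R]_d) : closed A -> measurable (A : set (borel_rV R d)).
  exact: borel_closed.
have mI := mb _ (closed_inner_parallel (e := k * L) cS).
have mH := mb _ (cH n w); have mS := mb _ cS.
have PSI : (PX (S `\` inner_parallel S (k * L)) <= (C * (k * L))%:E)%E.
  have kLr : k * L < r.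
    have : L <= r / k / 2 by exact: m0P.
    rewrite -mulrA -invfM ler_pdivlMr ?mulr_gt0 //; nra.
  have := rP (k * L).
  rewrite /ball /= sub0r normrN gtr0_norm // => /(_ kLr kL0).
  move=> /(le_trans (ler_norm _)); rewrite -lee_fin fineK //.
  by rewrite fin_num_measure //; exact: measurableD.
rewrite /dmeas (_ : H n w `\` S = set0); last first.
  by apply/seteqP; split=> x // -[/HSw].
rewrite measure0 add0e gee0_abs // lee_pdivrMr // -EFinM -mulrA.
apply: le_trans PSI; apply: le_measure; rewrite ?inE; try exact: measurableD.
by apply: setDS; exact: mP.
Qed.

End Rate.

Theorem theorem6 (R : realType) (d : nat) (hd : (0 < d)%N) (rho h : R)
    (hrho : 0 < rho <= pi) (hh : 0 < h)
    (disp : measure_display) (Omega : measurableType disp)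
    (P : probability Omega R) (PX : probability (borel_rV R d) R)
    (X : nat -> {RV P >-> borel_rV R d}) (S : set 'rV[R]_d)
    (hX : iid_sample X PX) (hS : S = msupport PX)
    (hcompact : compact S) (hstd : standard PX S)
    (hinner : (fun t : R => fine (PX (S `\` inner_parallel S t)))
                =O_ (0^'+) (fun t : R => t)) :
  (cone_class rho h S ->
     as_bigO P
       (fun n w => dmeas PX (cone_hull rho h (sample_set X n w)) S)
       (log_rate d)) /\
  (ccone_class rho h S ->
     as_bigO P
       (fun n w => dmeas PX (ccone_hull rho h (sample_set X n w)) S)
       (log_rate d)).
Proof.
have cS : closed S by exact: compact_closed.
have subS : {ae P, forall w n, sample_set X n w `<=` S}.
  by rewrite hS; apply: (sample_sub_support_ae hX); rewrite -hS.
have [K K0 covS] := sample_covers_ae hX hd cS hstd.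
have /andP[k0 _] := cone_ratio_bounds hrho.
pose k := 4 * K / cone_ratio rho.
have kp : 0 < k by rewrite divr_gt0 // mulr_gt0.
have K2 : 0 < 2 * K by rewrite mulr_gt0.
(* From [m0] on, [e = K * log_rate d n] satisfies [2 * e <= cone_ratio rho * h], as both inclusion
   lemmas require. *)
have [m0 m0P] := log_rate_small hd (divr_gt0 (mulr_gt0 k0 hh) K2).
pose good e A := [/\ 0 < e, 2 * e <= cone_ratio rho * h &
  forall x, S x -> exists2 a : 'rV[R]_d, A a & eball x e a].
have coverS : {ae P, forall w, exists m, forall n, (m <= n)%N ->
    good (K * log_rate d n) (sample_set X n w)}.
  apply: filterS covS => w [m mP]; exists (maxn m (maxn m0 2)) => n.
  rewrite !geq_max => /andP[mn /andP[m0n n2]]; split; last exact: mP.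
  - by rewrite mulr_gt0 // log_rate_gt0.
  - by rewrite mulrA mulrC -ler_pdivlMr // m0P.
have kE n : k * log_rate d n = 4 * (K * log_rate d n) / cone_ratio rho.
  by rewrite /k (mulrA 4) mulrAC.
split=> classS; apply: (as_bigO_dmeas hd cS _ kp hinner).
- by move=> n w; exact: closed_cone_hull.
(* [S] is itself one of the sets whose intersection is the hull. *)
- by apply: filterS subS => w Sw n x; apply; split=> //; exact: Sw.
- apply: filterS coverS => w [m mP]; exists m => n /mP[e0 eh SA].
  by rewrite kE; exact: cone_hull_inner.
- by move=> n w; exact: closed_ccone_hull.
(* A cone disjoint from [S] is disjoint from the sample, so the hull of the sample lies in the hull
   of [S], which is [S]. *)
- apply: filterS subS => w Sw n x Hx; have [_ _ ->] := classS.
  move=> p [p1 pS]; apply: Hx; split=> //; rewrite -subset0 -pS.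
  exact: setIS (Sw n).
- apply: filterS coverS => w [m mP]; exists m => n /mP[e0 eh SA].
  by rewrite kE; exact: ccone_hull_inner.
Qed.
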